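(* Let $(\Omega,\mathcal F,\mathbb P)$ be a standard atomless probability space and $\mathcal X=L^\infty(\Omega,\mathcal F,\mathbb P)$. Let $h:[0,1]\to[0,1]$ be continuous and nondecreasing with $h(0)=0$ and $h(1)=1$, and let $\rho^h:\mathcal X\to\mathbb R$ be the associated distortion risk measure $$\rho^h(X)=\int_{-\infty}^0\big[h(\mathbb P(X>x))-1\big]\,dx+\int_0^\infty h(\mathbb P(X>x))\,dx .$$ Then $\rho^h$ is additive consistent if and only if $h(x)=x$ for all $x\in[0,1]$, in which case $\rho^h(X)=\mathbb E(X)$ for all $X\in\mathcal X$.
   Context: A map $\rho:\mathcal X\to\mathbb R$ is called additive consistent if for all $X,Y,Z\in\mathcal X$ such that $Z$ is independent of the pair $(X,Y)$, one has $\rho(X)\le\rho(Y)\Rightarrow\rho(X+Z)\le\rho(Y+Z)$. *)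

(* Defs.v *)
From HB Require Import structures.
From mathcomp Require Import all_boot all_order all_algebra.
From mathcomp Require Import all_classical all_reals all_analysis.

Set Implicit Arguments.
Unset Strict Implicit.
Unset Printing Implicit Defensive.

Import Order.TTheory GRing.Theory Num.Theory.
Import numFieldNormedType.Exports.

Local Open Scope classical_set_scope.
Local Open Scope ring_scope.

Definition completion_measurable d (T : measurableType d) (R : realType)
    (P : probability T R) (A : set T) : Prop :=
  exists B C : set T, [/\ measurable B, measurable C, B `<=` A, A `<=` C
    & P (C `\` B) = 0%E].

(* Standard in the sense of Rokhlin and Ito: off a null set N, f is an
   isomorphism onto its image in the line equipped with the law of f. Images
   are only required to be measurable for the completed law, so that both
   probability measures on standard Borel spaces (whose images under f are
   Borel) and complete Lebesgue-Rokhlin spaces qualify. Taking f real-valued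
   loses nothing, as Polish spaces are Borel isomorphic to Borel subsets of R. *)
Definition standard_probability d (T : measurableType d) (R : realType)
    (P : probability T R) : Prop :=
  exists (N : set T) (f : {mfun T >-> R}),
    [/\ measurable N, P N = 0%E,
        forall w1 w2, ~ N w1 -> ~ N w2 -> f w1 = f w2 -> w1 = w2
      & forall A, measurable A ->
          completion_measurable (distribution P f) (f @` (A `\` N))].

Definition atomless d (T : measurableType d) (R : realType)
    (P : probability T R) : Prop :=
  forall A : set T, measurable A -> (0 < P A)%E ->
    exists B : set T, [/\ measurable B, B `<=` A, (0 < P B)%E & (P B < P A)%E].

Definition independent_RV d (T : measurableType d) (R : realType)
    (P : probability T R) d1 (T1 : measurableType d1) d2 (T2 : measurableType d2)
    (U : T -> T1) (V : T -> T2) : Prop :=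
  forall (A : set T1) (B : set T2), measurable A -> measurable B ->
    P (U @^-1` A `&` V @^-1` B) = (P (U @^-1` A) * P (V @^-1` B))%E.

(* Elements of L^oo are given by representatives, i.e. essentially bounded
   random variables; see distortion_ae_eq for compatibility with almost sure
   equality. *)
Notation Linfty P := (LfunType P (leey 1)).

Definition additive_consistent d (T : measurableType d) (R : realType)
    (P : probability T R) (rho : Linfty P -> R) : Prop :=
  forall X Y Z : Linfty P,
    independent_RV P Z (fun w => (X w, Y w)) ->
    rho X <= rho Y -> rho (X + Z) <= rho (Y + Z).

Definition distortion d (T : measurableType d) (R : realType)
    (P : probability T R) (h : R -> R) (X : Linfty P) : R :=
  \int[lebesgue_measure]_(x in `]-oo, 0%R])
    (h (fine (P [set w | x < X w])) - 1) +
  \int[lebesgue_measure]_(x in `[0%R, +oo[) h (fine (P [set w | x < X w])).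

Arguments distortion {d T R} P h X.

Lemma distortion_ae_eq d (T : measurableType d) (R : realType)
    (P : probability T R) (h : R -> R) (X Y : Linfty P) :
  (\forall w \ae P, X w = Y w) -> distortion P h X = distortion P h Y.
Proof.
move=> XY.
have mX (Z : Linfty P) x : measurable [set w | x < Z w].
  rewrite (_ : [set _ | _] = Z @^-1` `]x, +oo[).
    by rewrite -[X in measurable X]setTI; exact: measurable_funPT.
  by apply/seteqP; split => w /=; rewrite in_itv/= andbT.
have PE x : P [set w | x < X w] = P [set w | x < Y w].
  case: XY => N [mN N0 hN].
  suff H (A B : set T) : measurable A -> measurable B ->
      A `<=` B `|` N -> (P A <= P B)%E.
    by apply/eqP; rewrite eq_le !H// => w xw;
      have [Nw|nNw] := pselect (N w); first [by right | left];
      move: xw; rewrite /= (contrapT (fun h => nNw (hN _ h))).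
  move=> mA mB AB; rewrite (le_trans (le_measure _ _ _ AB)) ?inE//.
    exact: measurableU.
  have /le_trans := @measureU2 _ _ _ P B N mB mN.
  by apply; rewrite [X in (_ + X)%E]N0 adde0.
by rewrite /distortion; congr (_ + _); apply: eq_Rintegral => x _; rewrite PE.
Qed.

(* Main.v *)
(* If A and B are independent events of probability p, the variables 1_A and the
   constant h p have the same value of rho^h; adding the independent 1_B gives
   the diagonal case of Hosszu's equation, h (p^2) + h (2p - p^2) = 2 h p. Then
   h - id solves the same equation and vanishes at 0 and 1, and where it attains
   its maximum at p in ]0, 1[ it also attains it at p^2, p^4, ..., which tend to
   0; so h - id <= 0, and likewise id - h <= 0. For h = id, rho^h is the layer
   cake formula for the expectation, which is additive. *)
Require Import Defs.
From HB Require Import structures.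
From mathcomp Require Import all_boot all_order all_algebra.
From mathcomp Require Import all_classical all_reals all_analysis.
From mathcomp Require Import lra measurable_realfun ess_sup_inf.

Set Implicit Arguments.
Unset Strict Implicit.
Unset Printing Implicit Defensive.

Import Order.TTheory GRing.Theory Num.Theory.
Import numFieldNormedType.Exports.

Local Open Scope classical_set_scope.
Local Open Scope ring_scope.

(** * The diagonal Hosszu equation *)

Lemma sub_sqr_itv01 (R : realFieldType) (p : R) : 0 < p -> p < 1 ->
  0 <= p *+ 2 - p ^+ 2 /\ p *+ 2 - p ^+ 2 <= 1.
Proof. by move=> p0 p1; split; nra. Qed.

Lemma hosszu_diagonal_le0 (R : realType) (f : R -> R) :
  {within `[0, 1], continuous f} -> f 0 = 0 -> f 1 = 0 ->
  (forall p : R, p \in `]0, 1[ -> f (p ^+ 2) + f (p *+ 2 - p ^+ 2) = f p *+ 2) ->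
  forall x : R, x \in `[0, 1] -> f x <= 0.
Proof.
move=> cf f0 f1 fE x x01.
have [c c01 fc] := EVT_max ler01 cf.
apply: (le_trans (fc _ x01)); rewrite leNgt; apply/negP => fc0.
have c_oo : c \in `]0, 1[.
  rewrite in_itv/= !lt_neqAle (itvP c01) !andbT.
  rewrite (itvP c01) andbT; apply/andP; split.
    by apply: contraTneq fc0 => <-; rewrite f0 ltxx.
  by apply: contraTneq fc0 => ->; rewrite f1 ltxx.
have cX n : (0 < n)%N -> c ^+ n \in `]0, 1[.
  move=> n0; rewrite in_itv/= exprn_gt0 ?(itvP c_oo)//=.
  by rewrite exprn_ilt1 ?(itvP c_oo)// -lt0n.
pose u (n : nat) : R := c ^+ (2 ^ n).
have uE n : f (u n) = f c.
  elim: n => [|n IHn]; first by rewrite /u expr1.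
  have u01 : u n \in `]0, 1[ by apply: cX; rewrite expn_gt0.
  have uS : u n.+1 = u n ^+ 2 by rewrite /u expnSr exprM.
  have := fE _ u01; rewrite -uS IHn => {}fE.
  have u1 : f (u n.+1) <= f c.
    by apply: fc; apply: subset_itv_oo_cc; apply: cX; rewrite expn_gt0.
  (* The argument is [1 - (1 - u n) ^+ 2], which stays in [0, 1]. Two values bounded by the maximum
     [f c] and averaging to it must both equal it. *)
  have u2 : f (u n *+ 2 - u n.+1) <= f c.
    rewrite uS; apply: fc; rewrite in_itv/=; apply/andP.
    by move: u01; rewrite in_itv/= => /andP[]; exact: sub_sqr_itv01.
  apply/eqP; by rewrite eq_le u1/=; lra.
have u0 : u n @[n --> \oo] --> 0.
  (* As [n < 2 ^ n] and [c] is below 1, [u n] lies between 0 and [c ^+ n]. *)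
  apply: (@squeeze_cvgr _ _ _ _ (cst 0) (GRing.exp c)).
  - apply: nearW => n; rewrite /u exprn_ge0 ?(itvP c_oo)//=.
    by rewrite ler_wiXn2l ?(itvP c_oo)// ltnW// ltn_expl.
  - exact: cvg_cst.
  - by apply: cvg_expr; rewrite ger0_norm ?(itvP c_oo).
have /continuous_within_itvP [//|_ /cvg_at_rightP f_at0 _] := cf.
(* Along the positive sequence [u], which tends to 0, [f] is constantly [f c]; right continuity at 0
   then forces [f c = f 0 = 0], against [fc0]. *)
have /f_at0 : (forall n, 0 < u n) /\ u n @[n --> \oo] --> 0.
  by split=> // n; rewrite exprn_gt0// (itvP c_oo).
rewrite f0; under eq_fun do rewrite uE.
move=> fc_cvg0; suff : f c = 0 by move/eqP; rewrite gt_eqF.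
by apply: (cvg_unique _ _ fc_cvg0) => //; exact: cvg_cst.
Qed.

Lemma hosszu_diagonal_id (R : realType) (h : R -> R) :
  {within `[0, 1], continuous h} -> h 0 = 0 -> h 1 = 1 ->
  (forall p : R, p \in `]0, 1[ -> h (p ^+ 2) + h (p *+ 2 - p ^+ 2) = h p *+ 2) ->
  forall x : R, x \in `[0, 1] -> h x = x.
Proof.
move=> ch h0 h1 hE x x01; apply/eqP; rewrite eq_le.
have cid : {within `[0, 1 : R], continuous id}.
  by apply: continuous_subspaceT => y; exact: cvg_id.
apply/andP; split; rewrite -subr_le0.
  apply: (@hosszu_diagonal_le0 _ (fun x => h x - x)) => //; rewrite ?h0 ?h1 ?subrr//.
    by move=> y; apply: cvgB; [exact: ch|exact: cid].
  by move=> p /hE; lra.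
apply: (@hosszu_diagonal_le0 _ (fun x => x - h x)) => //; rewrite ?h0 ?h1 ?subrr//.
  by move=> y; apply: cvgB; [exact: cid|exact: ch].
by move=> p /hE; lra.
Qed.

(** * Independent events of prescribed probability *)

Section atomless_events.
Context d (T : measurableType d) (R : realType) (P : probability T R).

Lemma cdf_ge_at_right (X : {RV P >-> R}) (t : R) (p : \bar R) :
  (forall u, t < u -> (p <= cdf X u)%E) -> (p <= cdf X t)%E.
Proof.
move=> pX; apply: (cvge_ge _ (@cdf_right_continuous _ _ _ P X t)).
by near=> u; apply: pX; near: u; exact: nbhs_right_gt.
Unshelve. all: by end_near. Qed.

(** An intermediate value argument: [t] is the supremum of the set [S] where the cdf is at most [p].
    The limits 0 and 1 of the cdf make [S] nonempty and bounded above, right continuity gives a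
    value of at least [p] at [t], and the absence of atoms gives at most [p]. *)
Lemma cdf_surj_noatom (X : {RV P >-> R}) (p : R) :
  (forall t, P (X @^-1` [set t]) = 0%E) -> 0 < p < 1 ->
  exists t, cdf X t = p%:E.
Proof.
move=> noatom /andP[p0 p1].
pose S := [set u | (cdf X u <= p%:E)%E].
have S0 : S !=set0.
  apply/not_existsP => H.
  suff : (p%:E <= 0%E)%E by rewrite lee_fin leNgt p0.
  apply: (cvge_ge _ (cvg_cdfNy0 X)); apply: nearW => u.
  by rewrite leNgt; apply/negP => /ltW; exact: H.
have SE t u : t < u -> S u -> S t.
  by move=> tu; apply: le_trans; apply: cdf_nondecreasing; exact: ltW.
have supS : has_sup S.
  split => //; apply: contrapT => /forallNP nub.
  suff : (1%E <= p%:E)%E by rewrite lee_fin leNgt p1.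
  apply: (cvge_le _ (cvg_cdfy1 X)); apply: nearW => u.
  have /existsNP[v /not_implyP[Sv /negP]] := nub u.
  by rewrite -ltNge => uv; exact: SE uv Sv.
exists (sup S); apply/eqP; rewrite eq_le; apply/andP; split; last first.
  apply: cdf_ge_at_right => u Su; rewrite leNgt; apply/negP => /ltW Su'.
  by have := ub_le_sup supS.2 Su'; rewrite leNgt Su.
have mX (A : set R) : measurable A -> measurable (X @^-1` A).
  by move=> mA; exact: measurable_funPTI.
(* The cdf of X has a left limit at most p at sup S; this is right continuity
   of the cdf of -X at - sup S, as cdf (-X) (-t) = 1 - cdf X t without atoms. *)
pose Y : {RV P >-> R} := - (X : {mfun T >-> R}).
have NXE t : cdf Y (- t) = (1 - cdf X t)%E.
  rewrite -ccdf_1_cdf /cdf /ccdf /distribution /pushforward.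
  rewrite (_ : _ @^-1` _ = (X @^-1` [set t]) `|` (X @^-1` `]t, +oo[)).
    rewrite measureU//; [|exact: mX|].
      by rewrite -[RHS]add0e; congr (_ + _)%E; exact: noatom.
    by rewrite -preimage_setI -subset0 => w/= [->]; rewrite in_itv/= ltxx.
  rewrite -preimage_setU setU1itv//; apply/seteqP; split => w;
    by rewrite /= !in_itv/= andbT lerN2.
have : (1 - p%:E <= cdf Y (- sup S))%E.
  apply: cdf_ge_at_right => u; rewrite ltrNl => /(sup_gt S0)[v Sv uv].
  by rewrite -[u]opprK NXE leeB//; exact: SE uv Sv.
by rewrite NXE leeD2lE// leeN2.
Qed.

(** Off the null set [N] the map [f] is injective, so a fibre of [f] has at most one point there. If
    that part had positive probability, atomlessness would give a subset of smaller positive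
    probability; being nonempty, this subset would be the whole part. *)
Lemma standard_atomless_noatom : standard_probability P -> atomless P ->
  exists f : {RV P >-> R}, forall t, P (f @^-1` [set t]) = 0%E.
Proof.
move=> [N [f [mN N0 finj _]]] atl; exists f => t.
have mf : measurable (f @^-1` [set t]) by exact: measurable_funPTI.
set A := f @^-1` [set t] `\` N.
have mA : measurable A by exact: measurableD.
have -> : P (f @^-1` [set t]) = P A.
  rewrite (measureDI P mf mN) [X in (_ + X)%E](_ : _ = 0%E) ?adde0//.
  apply/eqP; rewrite -measure_le0 -N0.
  by rewrite le_measure ?inE//; exact: measurableI.
apply/eqP; rewrite -measure_le0 leNgt; apply/negP => /(atl _ mA).
move=> [B [mB BA B0]]; rewrite ltNge => /negP; apply.
have [w Bw] : B !=set0.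
  by apply/set0P; apply: contraTneq B0 => ->; rewrite measure0 ltxx.
rewrite le_measure ?inE// => v [/= fv Nv].
by have [/= fw Nw] := BA _ Bw; rewrite (finj v w)// fv fw.
Qed.

(** Both events are cut out of three nested sublevel sets of [f], of probabilities p^2, p and 2p -
    p^2, the values wanted for the intersection, for one event and for the union. *)
Lemma exists_independent_events (f : {RV P >-> R}) (p : R) :
  (forall t, P (f @^-1` [set t]) = 0%E) -> 0 < p < 1 ->
  exists A B : set T, [/\ measurable A, measurable B, P A = p%:E, P B = p%:E &
    P (A `&` B) = (p ^+ 2)%:E].
Proof.
move=> noatom /andP[p0 p1].
have [t1 t1E] : exists t, cdf f t = (p ^+ 2)%:E.
  by apply: cdf_surj_noatom => //; apply/andP; split; nra.
have [t2 t2E] : exists t, cdf f t = p%:E.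
  by apply: cdf_surj_noatom => //; apply/andP; split; nra.
have [t3 t3E] : exists t, cdf f t = (p *+ 2 - p ^+ 2)%:E.
  by apply: cdf_surj_noatom => //; apply/andP; split; nra.
pose E t := f @^-1` `]-oo, t].
have mE t : measurable (E t) by exact: measurable_funPTI.
(* By monotonicity of the cdf, strictly ordered values come from ordered thresholds. *)
have ES s t : (cdf f s < cdf f t)%E -> E s `<=` E t.
  move=> st w; rewrite /E/= !in_itv/= => /le_trans; apply.
  by rewrite leNgt; apply: contraTN st => ts; rewrite -leNgt cdf_nondecreasing// ltW.
have E12 : E t1 `<=` E t2 by apply: ES; rewrite t1E t2E lte_fin; nra.
have E23 : E t2 `<=` E t3 by apply: ES; rewrite t3E t2E lte_fin; nra.
(* The second event meets [E t2] exactly in [E t1], and its probability is p^2 + (2p - p^2 - p) =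
   p. *)
exists (E t2), (E t1 `|` (E t3 `\` E t2)); split => //.
- by apply: measurableU => //; exact: measurableD.
- rewrite (_ : p = p ^+ 2 + (p *+ 2 - p ^+ 2 - p)); last by lra.
  rewrite measureU//; [|exact: measurableD|]; last first.
    by rewrite -subset0 => w [/E12 ? []].
  rewrite EFinD; congr (_ + _)%E; first exact: t1E.
  rewrite measureD//; last by rewrite -ge0_fin_numE ?fin_num_measure.
  rewrite EFinB; congr (_ - _)%E; first exact: t3E.
  by rewrite (setIidr E23); exact: t2E.
rewrite (_ : _ `&` _ = E t1)//; apply/seteqP; split => w; last first.
  by move=> /[dup] /E12 ? ?; split => //; left.
by case=> ? [//|[]].
Qed.

End atomless_events.

(** * Distortion and independence of step variables *)

Section step_variables.
Context d (T : measurableType d) (R : realType) (P : probability T R).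

Lemma bounded_Lfun_infty (f : T -> R) (M : R) :
  measurable_fun setT f -> (forall w, `|f w| <= M) -> f \in Lfun P +oo.
Proof.
move=> mf fM; rewrite inE; apply/andP; split; rewrite inE//=.
rewrite /finite_norm unlock /Lnorm; case: ifPn => // _.
apply: (@le_lt_trans _ _ M%:E); last exact: ltry.
by apply/ess_supP; apply: nearW => w; rewrite /= lee_fin.
Qed.

(** The survival function takes the values 1, [a], [b], 0 in turn, so the integral is the area of
    two rectangles. Equality [s = t] is allowed, so that one-step variables are covered. *)
Lemma distortion_two_step (h : R -> R) (X : Linfty P) (s t : R) (a b : \bar R) :
  h 0 = 0 -> h 1 = 1 -> 0 <= s -> s <= t ->
  (forall x : R, x < 0 -> P [set w | x < X w] = 1%E) ->
  (forall x : R, 0 <= x < s -> P [set w | x < X w] = a) ->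
  (forall x : R, s <= x < t -> P [set w | x < X w] = b) ->
  (forall x : R, t <= x -> P [set w | x < X w] = 0%E) ->
  distortion P h X = h (fine a) * s + h (fine b) * (t - s).
Proof.
move=> h0 h1 s0 st P1 Pa Pb P0; rewrite /distortion.
have neg0 (x : R) : x < 0 -> h (fine (P [set w | x < X w])) - 1 = 0.
  by move=> x0; rewrite P1//= h1 subrr.
(* The endpoint 0 is dropped because the integrand is known to vanish only for negative [x]. *)
rewrite -Rintegral_itv_bndo_bndc; last first.
  apply: (eq_integrable _ (cst 0%E)) => //; last exact: integrable0.
  by move=> x; rewrite inE/= in_itv/= => x0; rewrite neg0.
rewrite (@eq_Rintegral _ _ _ _ _ (cst 0)); last first.
  by move=> x; rewrite inE/= in_itv/= => x0; rewrite neg0.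
rewrite Rintegral_cst// mul0r add0r.
have itg (u v : R) : lebesgue_measure.-integrable `[0, +oo[ (EFin \o \1_(`[u, v[ : set R)).
  by apply: (integrableS measurableT) => //; exact: integrable_indic_itv.
have intE (u v : R) : 0 <= u -> u <= v ->
    \int[lebesgue_measure]_(x in `[0, +oo[) (\1_(`[u, v[ : set R) x : R) = v - u.
  move=> u0 uv; rewrite /Rintegral integral_indic//= (_ : _ `&` _ = `[u, v[%classic).
    rewrite lebesgue_measure_itv/= lte_fin.
    by move: uv; rewrite le_eqVlt => /predU1P[->|->]; rewrite ?ltxx ?subrr.
  apply/seteqP; split => x /=; rewrite !in_itv/= andbT; first by case.
  by move=> /andP[ux xv]; rewrite ux xv (le_trans u0).
transitivity (\int[lebesgue_measure]_(x in `[0, +oo[)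
    (h (fine a) * \1_(`[0, s[ : set R) x + h (fine b) * \1_(`[s, t[ : set R) x)).
  apply: eq_Rintegral => x; rewrite inE/= in_itv/= andbT => x0.
  rewrite !indicE !mem_setE !in_itv/= x0/=.
  have [xs|sx] := ltP x s; first by rewrite Pa ?x0// mulr1 mulr0 addr0.
  have [xt|tx] := ltP x t; first by rewrite Pb ?sx// mulr1 mulr0 add0r.
  by rewrite P0//= h0 !mulr0 addr0.
have itZ (k u v : R) :
    lebesgue_measure.-integrable `[0, +oo[ (EFin \o (fun x => k * \1_(`[u, v[ : set R) x)).
  rewrite (_ : _ \o _ = fun x => (k%:E * (EFin \o \1_(`[u, v[ : set R)) x)%E).
    by apply: integrableZl.
  by apply/funext => x; rewrite /= EFinM.
rewrite RintegralD//.
by rewrite !RintegralZl// !intE// subr0.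
Qed.

(** A preimage under an indicator is empty, everything, the event or its complement; it remains to
    pass the product rule from two events to their complements. *)
Lemma independent_RV_comp_indic d1 (T1 : measurableType d1) d2 (T2 : measurableType d2)
    (A B : set T) (U : R -> T1) (V : R -> T2) :
  measurable A -> measurable B -> P (A `&` B) = (P A * P B)%E ->
  independent_RV P (U \o \1_A) (V \o \1_B).
Proof.
move=> mA mB PAB C D _ _.
rewrite -[_ @^-1` C]/(\1_A @^-1` (U @^-1` C)) -[_ @^-1` D]/(\1_B @^-1` (V @^-1` D)).
rewrite !preimage_indic.
have fB (E : set T) : measurable E -> P E \is a fin_num.
  exact: fin_num_measure.
have indepC (E F : set T) : measurable E -> measurable F ->
    P (E `&` F) = (P E * P F)%E -> P (~` E `&` F) = (P (~` E) * P F)%E.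
  move=> mE mF PEF; transitivity (P F - P (E `&` F))%E.
    by rewrite setIC -setDE measureD 1?setIC// -ge0_fin_numE ?fB.
  by rewrite PEF probability_setC// muleBl ?mul1e ?fB.
have PAC : P (A `&` ~` B) = (P A * P (~` B))%E.
  by rewrite setIC muleC; apply: indepC; rewrite // setIC muleC.
have PCA := indepC _ _ mA mB PAB.
have PCC := indepC _ _ mA (measurableC mB) PAC.
by case: ifP => _; case: ifP => _; case: ifP => _; case: ifP => _;
  rewrite ?(set0I, setI0, setTI, setIT, measure0, probability_setT);
  rewrite ?(mul0e, mule0, mul1e, mule1).
Qed.

End step_variables.

(** * The identity distortion and the expectation *)

Lemma Linfty_Lfun1 d (T : measurableType d) (R : realType)
    (P : probability T R) (X : Linfty P) : (X : T -> R) \in Lfun P 1.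
Proof.
apply: (@Lfun_subset _ _ _ P 1 +oo%E (lexx _) (leey 1) _ (leey 1)) (LfunP X).
exact: fin_num_measure.
Qed.

Lemma distortion_id_expectation d (T : measurableType d) (R : realType)
    (P : probability T R) (h : R -> R) (X : Linfty P) :
  (forall x, x \in `[0, 1] -> h x = x) -> ((distortion P h X)%:E = 'E_P[X])%E.
Proof.
move=> hid.
have L1 := Linfty_Lfun1 X.
have := expectation_fin_num L1.
(* A finite expectation makes both layer cake integrals finite, which lets the [fine] hidden in the
   real-valued integrals be removed. *)
rewrite (expectation_cdf_ccdf (X := X)) // fin_numB => /andP[fc fd].
have ccdfE x : P [set w | x < X w] = ccdf (P := P) X x.
  by rewrite /ccdf /distribution /pushforward; congr (P _);
    apply/seteqP; split => w /=; rewrite in_itv/= andbT.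
have PX01 x : fine (P [set w | x < X w]) \in `[0, 1].
  rewrite ccdfE in_itv/= fine_ge0//= -lee_fin fineK ?probability_le1//.
  by rewrite fin_num_measure.
have ccdfK x : (fine (ccdf (P := P) X x))%:E = ccdf (P := P) X x.
  by rewrite fineK// fin_num_measure.
rewrite /distortion EFinD addeC; congr (_ + _)%E.
  rewrite /Rintegral -[RHS]fineK//; congr (fine _)%:E.
  by apply: eq_integral => x _; rewrite hid// ccdfE.
rewrite /Rintegral; transitivity
    (fine (\int[lebesgue_measure]_(x in `]-oo, 0%R]) (- cdf (P := P) X x))%E)%:E.
  congr (fine _)%:E; apply: eq_integral => x _; rewrite hid// ccdfE EFinB ccdfK ccdf_1_cdf.
  by rewrite addeAC subee// add0e.
rewrite -integral_itv_bndo_bndc; last first.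
  by apply/measurable_funTS/measurableT_comp => //; exact: cdf_measurable.
by rewrite integral_ge0N// fineK// fin_numN.
Qed.

(** * From additive consistency to the functional equation *)

(** The indicator of [A] and the constant [c] have equal risk, so consistency in both directions
    equates the risks after adding the indicator of [B]. The sign condition on [c] puts the jumps of
    [Y + Z] in the order required by [distortion_two_step]. *)
Lemma additive_consistent_indep_events d (T : measurableType d) (R : realType)
    (P : probability T R) (h : R -> R) (A B : set T) :
  h 0 = 0 -> h 1 = 1 -> 0 <= h (fine (P A)) ->
  additive_consistent (distortion P h) -> measurable A -> measurable B ->
  P (A `&` B) = (P A * P B)%E ->
  h (fine (P (A `|` B))) + h (fine (P (A `&` B))) = h (fine (P A)) + h (fine (P B)).
Proof.
move=> h0 h1 c0 ac mA mB PAB; set c := h (fine (P A)) in c0 *.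
have indicL (E : set T) : measurable E -> (\1_E : T -> R) \in Lfun P +oo.
  move=> mE; apply: (@bounded_Lfun_infty _ _ _ _ _ 1); first exact: measurable_indic.
  by move=> w; rewrite indicE; case: (_ \in _); rewrite ?normr1 ?normr0.
have cstL : (cst c : T -> R) \in Lfun P +oo.
  by apply: (@bounded_Lfun_infty _ _ _ _ _ `|c|) => //; exact: measurable_cst.
pose X : Linfty P := Lfun_Sub (leey 1) (indicL A mA).
pose Y : Linfty P := Lfun_Sub (leey 1) cstL.
pose Z : Linfty P := Lfun_Sub (leey 1) (indicL B mB).
have XZE w : (X + Z) w = \1_A w + \1_B w by [].
have YZE w : (Y + Z) w = c + \1_B w by [].
have PT (Q : T -> Prop) : (forall w, Q w) -> P [set w | Q w] = 1%E.
  by move=> allQ; rewrite -(probability_setT P); congr (P _); apply/seteqP;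
    split => // w _; exact: allQ.
have P0 (Q : T -> Prop) : (forall w, ~ Q w) -> P [set w | Q w] = 0%E.
  by move=> noQ; rewrite -(measure0 P); congr (P _); apply/seteqP; split => // w /noQ.
have PE (Q : T -> Prop) (E : set T) : (forall w, Q w <-> E w) -> P [set w | Q w] = P E.
  by move=> QE; congr (P _); apply/seteqP; split => w /QE.
have rhoX : distortion P h X = c.
  (* A single step: with [s = t] the second level is a dummy 0, its condition being vacuous; the
     same holds for [Y] below. *)
  rewrite (@distortion_two_step _ _ _ _ _ _ 1 1 (P A) 0%E)//.
  - by rewrite subrr mulr0 addr0 mulr1.
  - by move=> x x0; apply: PT => w; rewrite /= indicE; case: (_ \in _) => /=; lra.
  - move=> x /andP[x0 x1]; apply: PE => w; rewrite /= indicE.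
    have [Aw|nAw] := pselect (A w); last by rewrite memNset//=; split=> //; lra.
    by rewrite mem_set.
  - by move=> x /andP[/le_lt_trans/[apply]]; rewrite ltxx.
  - by move=> x x1; apply: P0 => w; rewrite /= indicE; case: (_ \in _) => /=; lra.
have rhoY : distortion P h Y = c.
  rewrite (@distortion_two_step _ _ _ _ _ _ c c 1%E 0%E)//.
  - by rewrite /= h1 subrr mulr0 addr0 mul1r.
  - by move=> x x0; apply: PT => w /=; lra.
  - by move=> x /andP[x0 x1]; apply: PT.
  - by move=> x /andP[/le_lt_trans/[apply]]; rewrite ltxx.
  - by move=> x x1; apply: P0 => w /=; lra.
have rhoXZ : distortion P h (X + Z) = h (fine (P (A `|` B))) + h (fine (P (A `&` B))).
  (* The sum counts how many of the two events occur: at least one is the union, both is the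
     intersection. *)
  rewrite (@distortion_two_step _ _ _ _ _ _ 1 2 (P (A `|` B)) (P (A `&` B)))//.
  - by rewrite mulr1 (_ : 2 - 1 = 1) ?mulr1//; lra.
  - by lra.
  - move=> x x0; apply: PT => w; rewrite XZE !indicE.
    by case: (w \in A); case: (w \in B) => /=; lra.
  - move=> x /andP[x0 x1]; apply: PE => w; rewrite XZE !indicE /setU/=.
    by have [Aw|nAw] := pselect (A w); have [Bw|nBw] := pselect (B w);
      rewrite ?(mem_set Aw) ?(memNset nAw) ?(mem_set Bw) ?(memNset nBw)/=;
      split; try lra; tauto.
  - move=> x /andP[x0 x1]; apply: PE => w; rewrite XZE !indicE /setI/=.
    by have [Aw|nAw] := pselect (A w); have [Bw|nBw] := pselect (B w);
      rewrite ?(mem_set Aw) ?(memNset nAw) ?(mem_set Bw) ?(memNset nBw)/=;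
      split; try lra; tauto.
  - move=> x x1; apply: P0 => w; rewrite XZE !indicE.
    by case: (w \in A); case: (w \in B) => /=; lra.
have rhoYZ : distortion P h (Y + Z) = c + h (fine (P B)).
  rewrite (@distortion_two_step _ _ _ _ _ _ c (c + 1) 1%E (P B))//.
  - by rewrite /= h1 mul1r addrAC subrr add0r mulr1.
  - by lra.
  - move=> x x0; apply: PT => w; rewrite YZE indicE.
    by case: (w \in B) => /=; lra.
  - move=> x /andP[x0 x1]; apply: PT => w; rewrite YZE indicE.
    by case: (w \in B) => /=; lra.
  - move=> x /andP[x0 x1]; apply: PE => w; rewrite YZE indicE.
    by have [Bw|nBw] := pselect (B w);
      rewrite ?(mem_set Bw) ?(memNset nBw)/=;
      split; try lra; tauto.
  - move=> x x1; apply: P0 => w; rewrite YZE indicE.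
    by case: (w \in B) => /=; lra.
have PBA : P (B `&` A) = (P B * P A)%E by rewrite setIC muleC.
(* As [Y] is constant, the pair is a function of the indicator of [A] alone. Both orders of the pair
   are needed, one for each inequality. *)
have indepXY : independent_RV P Z (fun w => (X w, Y w)).
  exact: (independent_RV_comp_indic id (fun x => (x, c)) mB mA PBA).
have indepYX : independent_RV P Z (fun w => (Y w, X w)).
  exact: (independent_RV_comp_indic id (fun x => (c, x)) mB mA PBA).
rewrite -rhoXZ -rhoYZ; apply/eqP; rewrite eq_le.
by apply/andP; split; apply: ac; rewrite ?rhoX ?rhoY.
Qed.

Theorem theorem3p2 (R : realType) (d : measure_display) (T : measurableType d)
    (P : probability T R) (h : R -> R)
    (P_standard : standard_probability P)
    (P_atomless : atomless P)
    (h_range : forall x, x \in `[0, 1] -> h x \in `[0, 1])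
    (h_continuous : {within `[0, 1], continuous h})
    (h_nondecreasing : {in `[0, 1] &, {homo h : x y / x <= y}})
    (h0 : h 0 = 0)
    (h1 : h 1 = 1) :
  (additive_consistent (distortion P h) <->
    (forall x, x \in `[0, 1] -> h x = x)) /\
  ((forall x, x \in `[0, 1] -> h x = x) ->
    forall X : Linfty P, ((distortion P h X)%:E = 'E_P[X])%E).
Proof.
split=> [|hid X]; last exact: distortion_id_expectation.
split=> [ac|hid X Y Z _].
  have [f noatom] := standard_atomless_noatom P_standard P_atomless.
  apply: hosszu_diagonal_id => // p p01.
  have [|A [B [mA mB PA PB PAB]]] := exists_independent_events (p := p) noatom.
    by move: p01; rewrite in_itv.
  (* Inclusion-exclusion turns the identity for [A] and [B] into the diagonal equation at [p]. *)
  have PU : P (A `|` B) = (p *+ 2 - p ^+ 2)%:E.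
    transitivity (P A + P B - P (A `&` B))%E.
      by apply: measureUfinr => //; rewrite -ge0_fin_numE ?fin_num_measure.
    by rewrite PA PB PAB mulr2n.
  have := additive_consistent_indep_events h0 h1 _ ac mA mB.
  rewrite PAB PA PB PU -EFinM expr2 => /(_ _ erefl)/=.
  rewrite -expr2 addrC mulr2n; apply.
  by have := h_range _ (subset_itv_oo_cc p01); rewrite in_itv/= => /andP[].
have LE := @Linfty_Lfun1 _ _ _ P.
(* Comparing risks now means comparing expectations, and adding the finite expectation of [Z]
   preserves the order. *)
have rho_le (V W : Linfty P) :
    (distortion P h V <= distortion P h W) = ('E_P[V] <= 'E_P[W])%E.
  by rewrite -lee_fin !distortion_id_expectation.
move=> XY; have {}XY : ('E_P[X] <= 'E_P[Y])%E by rewrite -rho_le.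
rewrite rho_le (expectationD (LE X) (LE Z)) (expectationD (LE Y) (LE Z)).
exact: leeD.
Qed.
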